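(* Let $K$ be a compact space. (1) $C(K)$ has the Daugavet property if and only if $K$ has no isolated points. Moreover, if $K$ has an isolated point, then $\mathfrak{oct}(C(K))=1$. (2) $C(K)$ has the perfect Daugavet property if and only if $K$ has no $G_\delta$-points. Moreover, in this case, $\mathfrak{pDau}(C(K))\geq\omega$.
   Context: All topological spaces are Hausdorff and all Banach spaces are real; $C(K)$ is the space of real continuous functions on $K$ with the sup norm. A point $x\in K$ is a $G_\delta$-point if $\{x\}$ is a countable intersection of open sets. $B_X$ and $S_X$ denote the closed unit ball and unit sphere of a Banach space $X$. A slice of $B_X$ is a nonempty intersection of $B_X$ with an open half-space, i.e. a set $\{x\in B_X: f(x)>\sup f(B_X)-\alpha\}$ with $f\in X^*$, $\alpha>0$. For a cardinal $\kappa$ (finite or infinite), $\{y_\alpha:\alpha<\kappa\}$ denotes a set of cardinality at most $\kappa$. $X$ has the Daugavet property if every rank-one bounded linear operator $T:X\to X$ satisfies $\|\mathrm{Id}+T\|=1+\|T\|$. $X$ has the $\kappa$-perfect Daugavet property if for every family $\{y_\alpha:\alpha<\kappa\}\subseteq S_X$ and every slice $S$ of $B_X$ there is $x\in S$ with $\|y_\alpha+x\|=2$ for all $\alpha<\kappa$. The perfect Daugavet property is the $1$-perfect Daugavet property. For nonzero $X$, $\mathfrak{pDau}(X)$ is the least cardinal $\kappa$ such that $X$ fails the $\kappa$-perfect Daugavet property. $X$ is $\kappa$-octahedral if for every $\{y_\alpha:\alpha<\kappa\}\subseteq S_X$ and every $\varepsilon>0$ there is $x\in S_X$ such that $\|y_\alpha+x\|>2-\varepsilon$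 and $\|y_\alpha-x\|>2-\varepsilon$ for every $\alpha<\kappa$. For nonzero $X$, $\mathfrak{oct}(X)$ is the least cardinal $\kappa$ such that $X$ fails to be $\kappa$-octahedral. $\omega$ is the first infinite cardinal. *)

(* Defs.v *)
From HB Require Import structures.
From mathcomp Require Import all_boot all_order all_algebra.
From mathcomp Require Import all_classical all_reals all_analysis.

Set Implicit Arguments.
Unset Strict Implicit.
Unset Printing Implicit Defensive.

Import Order.TTheory GRing.Theory Num.Theory.
Import numFieldNormedType.Exports.

Local Open Scope classical_set_scope.
Local Open Scope card_scope.
Local Open Scope ring_scope.

(* The space C(K).  The compactness proof is a parameter of the carrier because
   the sup norm is a norm only when every continuous function is bounded. *)
Definition contfun (R : realType) (K : topologicalType)
  (cK : compact [set: K]) : Type := continuousType K R.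

Section contfun.
Variables (R : realType) (K : topologicalType) (cK : compact [set: K]).
Local Notation CK := (contfun R cK).
Implicit Types (f g h : CK) (a b : R).

Lemma contfunP f g : f = g <-> (f : K -> R) =1 g.
Proof. exact: continuousEP. Qed.

Lemma contfun_continuous f : continuous (f : K -> R).
Proof. exact: cts_fun. Qed.

Fact contfun_add_subproof f g : continuous (fun t => f t + g t : R).
Proof. by move=> t; apply: cvgD; exact: contfun_continuous. Qed.
Fact contfun_opp_subproof f : continuous (fun t => - f t : R).
Proof. by move=> t; apply: cvgN; exact: contfun_continuous. Qed.
Fact contfun_scale_subproof a f : continuous (fun t => a * f t : R).
Proof. by move=> t; apply: cvgMr; exact: contfun_continuous. Qed.

Definition contfun_zero : CK := mkcts (fun t : K => @cst_continuous K R 0 t).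
Definition contfun_add f g : CK := mkcts (@contfun_add_subproof f g).
Definition contfun_opp f : CK := mkcts (@contfun_opp_subproof f).
Definition contfun_scale a f : CK := mkcts (@contfun_scale_subproof a f).

HB.instance Definition _ := Choice.on CK.

Fact contfun_addA : associative contfun_add.
Proof. by move=> f g h; apply/contfunP => t; exact: addrA. Qed.
Fact contfun_addC : commutative contfun_add.
Proof. by move=> f g; apply/contfunP => t; exact: addrC. Qed.
Fact contfun_add0 : left_id contfun_zero contfun_add.
Proof. by move=> f; apply/contfunP => t; exact: add0r. Qed.
Fact contfun_addN : left_inverse contfun_zero contfun_opp contfun_add.
Proof. by move=> f; apply/contfunP => t; exact: addNr. Qed.

HB.instance Definition _ := GRing.isZmodule.Build CK
  contfun_addA contfun_addC contfun_add0 contfun_addN.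

Fact contfun_scaleA a b f :
  contfun_scale a (contfun_scale b f) = contfun_scale (a * b) f.
Proof. by apply/contfunP => t; exact: mulrA. Qed.
Fact contfun_scale1 : left_id 1 contfun_scale.
Proof. by move=> f; apply/contfunP => t; exact: mul1r. Qed.
Fact contfun_scaleDr : right_distributive contfun_scale +%R.
Proof. by move=> a f g; apply/contfunP => t; exact: mulrDr. Qed.
Fact contfun_scaleDl f : {morph contfun_scale^~ f : a b / a + b}.
Proof. by move=> a b; apply/contfunP => t; exact: mulrDl. Qed.

HB.instance Definition _ := GRing.Zmodule_isLmodule.Build R CK
  contfun_scaleA contfun_scale1 contfun_scaleDr contfun_scaleDl.

(* On the empty space this is [sup set0 = 0]. *)
Definition contfun_norm f : R := sup [set `|f t| | t in [set: K]].

Lemma contfun_has_ubound f : has_ubound [set `|f t| | t in [set: K]].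
Proof.
have /compact_bounded[M [_ MP]] : compact ((f : K -> R) @` [set: K]).
  apply: continuous_compact => //.
  exact/continuous_subspaceT/contfun_continuous.
exists (M + 1) => _ [t _ <-]; apply: (MP (M + 1)); first by rewrite ltrDl.
by exists t.
Qed.

Lemma contfun_norm_ge f t : `|f t| <= contfun_norm f.
Proof. by apply: sup_ubound; [exact: contfun_has_ubound|exists t]. Qed.

Lemma contfun_norm_ge0 f : 0 <= contfun_norm f.
Proof.
have [[t _]|K0] := pselect ([set: K] !=set0).
  exact: le_trans (contfun_norm_ge f t).
rewrite /contfun_norm; suff -> : [set: K] = set0 by rewrite image_set0 sup0.
by apply/eqP; apply: contrapT => /negP/set0P.
Qed.

Lemma contfun_norm_le f a : 0 <= a -> (forall t, `|f t| <= a) ->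
  contfun_norm f <= a.
Proof.
move=> a0 fa; have [K0|K0] := pselect ([set `|f t| | t in [set: K]] !=set0).
  by apply: ge_sup => // _ [t _ <-].
rewrite /contfun_norm; suff -> : [set `|f t| | t in [set: K]] = set0.
  by rewrite sup0.
by apply/eqP; apply: contrapT => /negP/set0P.
Qed.

Fact contfun_ler_normD f g :
  contfun_norm (f + g) <= contfun_norm f + contfun_norm g.
Proof.
apply: contfun_norm_le => [|t]; first by rewrite addr_ge0 ?contfun_norm_ge0.
by apply: le_trans (ler_normD _ _) _; rewrite lerD ?contfun_norm_ge.
Qed.

Fact contfun_normrZ a f : contfun_norm (a *: f) = `|a| * contfun_norm f.
Proof.
apply/eqP; rewrite eq_le; apply/andP; split.
  apply: contfun_norm_le => [|t]; first by rewrite mulr_ge0 ?contfun_norm_ge0.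
  by rewrite [leLHS]normrM ler_wpM2l ?contfun_norm_ge.
have [->|a0] := eqVneq a 0; first by rewrite normr0 mul0r contfun_norm_ge0.
rewrite -ler_pdivlMl ?normr_gt0//; apply: contfun_norm_le => [|t].
  by rewrite mulr_ge0 ?invr_ge0 ?contfun_norm_ge0.
by rewrite ler_pdivlMl ?normr_gt0// -normrM; exact: (contfun_norm_ge (a *: f)).
Qed.

Fact contfun_normr0_eq0 f : contfun_norm f = 0 -> f = 0.
Proof.
move=> f0; apply/contfunP => t; apply/eqP.
by rewrite -[_ == _]normr_le0 -f0 contfun_norm_ge.
Qed.

HB.instance Definition _ := Lmodule_isNormed.Build R CK
  contfun_ler_normD contfun_normrZ contfun_normr0_eq0.

Lemma contfun_normE f : `|f| = sup [set `|f t| | t in [set: K]].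
Proof. by []. Qed.

End contfun.

Section daugavet.
Variables (R : realType) (X : normedModType R).
Implicit Types (Y S : set X).

Definition unit_ball : set X := [set x | `|x| <= 1].
Definition unit_sphere : set X := [set x | `|x| = 1].

Definition opnorm (T : X -> X) : R := sup [set `|T x| | x in unit_ball].

Definition rank_one (T : X -> X) :=
  exists2 e : X, e != 0 & range T = [set a *: e | a in [set: R]].

Definition daugavet :=
  forall T : {linear X -> X}, bounded_fun_norm T -> rank_one T ->
    opnorm (fun x => x + T x) = 1 + opnorm T.

Definition slice S :=
  exists (f : {linear X -> R^o}) (a : R), [/\ continuous f, 0 < a &
    S = [set x | unit_ball x /\ sup [set f z | z in unit_ball] - a < f x]].

(* Cardinals are represented by sets in arbitrary types, compared by [#<=]; a
   family {y_i : i < kappa} is a set Y with [Y #<= kappa]. *)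
Definition perfect_daugavet I (kappa : set I) :=
  forall Y S, Y `<=` unit_sphere -> Y #<= kappa -> slice S ->
    exists2 x, S x & forall y, Y y -> `|y + x| = 2.

Definition octahedral I (kappa : set I) :=
  forall Y (e : R), Y `<=` unit_sphere -> Y #<= kappa -> 0 < e ->
    exists2 x, unit_sphere x &
      forall y, Y y -> 2 - e < `|y + x| /\ 2 - e < `|y - x|.

Definition least_cardinal (P : forall I, set I -> Prop) J (kappa : set J) :=
  P J kappa /\ forall I (lambda : set I), P I lambda -> kappa #<= lambda.

(* When X is nonzero, both properties fail for the cardinal of the unit sphere,
   so the least cardinal for which they fail is that of some subset of X.  For
   X = 0 no cardinal fails and the value [set0] is meaningless. *)
Definition pDau : set X := xget set0
  [set kappa | least_cardinal (fun I l => ~ @perfect_daugavet I l) kappa].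

Definition oct : set X := xget set0
  [set kappa | least_cardinal (fun I l => ~ @octahedral I l) kappa].

End daugavet.

Arguments unit_ball {R} X _ /.
Arguments unit_sphere {R} X _ /.
Arguments pDau {R} X.
Arguments oct {R} X.

(* Main.v *)
(* Given [f] in the ball of [C(K)], an infinite set [F] of points and a bounded
   functional [phi], adding to [f] multiples of many bumps of sum at most [1]
   peaking in [F] shows that [f] can be given a prescribed value of modulus at
   most [1] at some point of [F] while [phi f] hardly changes.  Without isolated
   points this applies to [F] a nonempty open set, which gives the Daugavet
   property; without G_delta points it applies to [F = {t | y t = y q}] with
   [|y q| = |y| = 1], successively for finitely many [y], which gives the perfect
   Daugavet property for finite families.  Conversely, an isolated point [x] has
   a continuous indicator [b], and [f |-> - f x *: b] and [b] refute the Daugavet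
   property and octahedrality; a G_delta point [x] has a peak function [y], and
   [- y] refutes the perfect Daugavet property on the slice [f x > 0]. *)
Require Import Defs.
From HB Require Import structures.
From mathcomp Require Import all_boot all_order all_algebra.
From mathcomp Require Import all_classical all_reals all_analysis.
From mathcomp Require Import borel_hierarchy.
From mathcomp Require Import ring lra.

Import Order.TTheory GRing.Theory Num.Theory.
Import numFieldNormedType.Exports.

Local Open Scope classical_set_scope.
Local Open Scope card_scope.
Local Open Scope ring_scope.

(** * Comparison of cardinals *)

(* Zorn's lemma gives a maximal set [G] of partial choice functions that take
   pairwise distinct values at every index; by maximality [G] evaluates onto
   some [A j], which therefore injects into every [A i] through [G]. *)
Lemma cardinal_well_founded (J : Type) (T : J -> Type)
    (A : forall j, set (T j)) : inhabited J ->
  exists j, forall i, A j #<= A i.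
Proof.
move=> [j0].
have [[i Ai0]|An0] := pselect (exists i, A i = set0).
  by exists i => k; rewrite Ai0.
pose P (G : set (forall j, T j)) :=
  (forall g, G g -> forall j, A j (g j)) /\
  (forall g h, G g -> G h -> forall j, g j = h j -> g = h).
have [|G [[GA Ginj] Gmax]] := @Zorn_bigcup _ P.
  move=> F FP totF; split=> [g [G FG Gg]|g h [G FG Gg] [H FH Hh] j gh].
    by have [+ _] := FP _ FG; apply.
  have [GH|HG] := totF _ _ FG FH.
    by have [_ Hinj] := FP _ FH; exact: (Hinj g h (GH g Gg) Hh j gh).
  by have [_ Ginj] := FP _ FG; exact: (Ginj g h Gg (HG h Hh) j gh).
have [j Gj] : exists j, forall a, A j a -> exists2 g, G g & g j = a.
  apply: contrapT => nj.
  have newval j : exists a, A j a /\ forall g, G g -> g j <> a.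
    apply: contrapT => na; apply: nj; exists j => a Aa.
    apply: contrapT => nG; apply: na; exists a; split => // g Gg gja.
    by apply: nG; exists g.
  pose g0 j := sval (cid (newval j)).
  have g0P j : A j (g0 j) /\ forall g, G g -> g j <> g0 j.
    exact: (svalP (cid (newval j))).
  apply: (Gmax (g0 |` G)).
    split; last by move=> GG; have [_ /(_ g0)] := g0P j0; apply => //; apply: GG; left.
    by move=> g Gg; right.
  split=> [g [->|Gg] i|g h [->|Gg] [->|Gh] i gh //].
  - by have [] := g0P i.
  - exact: GA.
  - by have [_ /(_ h Gh)] := g0P i; rewrite gh.
  - by have [_ /(_ g Gg)] := g0P i; rewrite gh.
  - exact: Ginj gh.
exists j => i.
have [b0 Ab0] : A i !=set0.
  by apply/set0P/eqP => Ai0; apply: An0; exists i.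
have /choice[f fP] : forall a, exists b, A j a -> exists g, [/\ G g, g j = a & g i = b].
  move=> a; have [/Gj[g Gg gja]|nAa] := pselect (A j a); last by exists b0.
  by exists (g i) => _; exists g.
have /injfunPex[h] : exists2 f : T j -> T i, set_fun (A j) (A i) f & set_inj (A j) f.
  exists f => [a /fP[g [Gg _ <-]]|a b]; first exact: GA.
  rewrite !inE => /fP[g [Gg <- <-]] /fP[h [Gh <- <-]] gh.
  by rewrite (Ginj _ _ Gg Gh i gh).
exact: inj_card_le h.
Qed.

(** Well-foundedness for a family indexed by [bool]: its minimal member embeds in the other. *)
Lemma card_le_total {T U : Type} (A : set T) (B : set U) : A #<= B \/ B #<= A.
Proof.
have [[|] H] := @cardinal_well_founded bool (fun b => if b then T else U)
  (fun b => if b return set (if b then T else U) then A else B) (inhabits true).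
- by left; exact: (H false).
- by right; exact: (H true).
Qed.

(** Minimizing among subsets of [J] suffices: a [lambda] into which [S] does not embed is
    equinumerous with a subset of [S], to which monotonicity carries [P]. *)
Lemma least_cardinal_exists (P : forall I, set I -> Prop) J (S : set J) :
  (forall I I' (A : set I) (B : set I'), A #<= B -> P I A -> P I' B) ->
  P J S -> exists kappa : set J, least_cardinal P kappa.
Proof.
move=> Pmono PS.
have [[kappa Pk] kmin] := @cardinal_well_founded {A : set J | P J A} (fun=> J)
  sval (inhabits (exist _ S PS)).
exists kappa; split=> // I lambda Pl.
have [Sl|/card_subP[C Cl CS]] := card_le_total S lambda.
  by apply: card_le_trans Sl; exact: (kmin (exist _ S PS)).
have /andP[Cle leC] : (C #<= lambda) && (lambda #<= C) by rewrite -card_eq_le.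
apply: card_le_trans Cle.
exact: (kmin (exist _ C (Pmono _ _ _ _ leC Pl))).
Qed.

(** * Least failing cardinals in a normed space *)

Section cardinal_invariants.
Context {R : realType} {X : normedModType R}.

Lemma perfect_daugavet_le {I I'} {A : set I} {B : set I'} : A #<= B ->
  @perfect_daugavet R X _ B -> @perfect_daugavet R X _ A.
Proof. by move=> AB pB Y S YS YA; apply: pB => //; exact: card_le_trans AB. Qed.

(** The zero functional with [a = 1] imposes only [-1 < 0]. *)
Lemma slice_unit_ball : slice (unit_ball X).
Proof.
exists (GRing.null_fun R^o : {linear X -> R^o}), 1; split => //.
  by move=> x; exact: cvg_cst.
have -> : [set (GRing.null_fun R^o : {linear X -> R^o}) z | z in unit_ball X]
    = [set 0].
  apply/seteqP; split => [_ [z _ <-]//|_ ->].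
  by exists 0 => //=; rewrite normr0.
rewrite sup1; apply/seteqP; split => [x|x []//].
by move=> x1; split => //=; rewrite ltrBlDr.
Qed.

Lemma unit_sphere_neq0 : (exists x : X, x != 0) -> unit_sphere X !=set0.
Proof.
move=> [x x0]; exists (`|x|^-1 *: x) => /=.
by rewrite normrZ ger0_norm ?invr_ge0// mulVf// normr_eq0.
Qed.

(** A witness [x] for the whole sphere lies on it, since [2 = |y0 + x| <= 1 + |x|]; then [- x]
    belongs to the family, but [|- x + x| = 0]. *)
Lemma unit_sphere_not_perfect_daugavet : (exists x : X, x != 0) ->
  ~ @perfect_daugavet R X _ (unit_sphere X).
Proof.
move=> /unit_sphere_neq0[y0 y01] /(_ (unit_sphere X) (unit_ball X)).
case=> // [|x /= x1 xP]; first exact: slice_unit_ball.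
have nx1 : `|x| = 1.
  apply/eqP; rewrite eq_le x1/=.
  by have := ler_normD y0 x; rewrite (xP _ y01) y01; lra.
have := xP (- x); rewrite /= normrN addNr normr0 => /(_ nx1) /eqP.
by rewrite eq_sym pnatr_eq0.
Qed.

Lemma infinite_pDau : (exists x : X, x != 0) ->
  (forall I (A : set I), finite_set A -> @perfect_daugavet R X _ A) ->
  [set: nat] #<= pDau X.
Proof.
move=> X0 pfin; rewrite -infiniteP => finp.
have [] : least_cardinal (fun I l => ~ @perfect_daugavet R X I l) (pDau X).
  (* As a least failing cardinal exists, [xget] returns one instead of its default [set0]. *)
  apply: (xgetPex (set0 : set X)
    (P := [set kappa | least_cardinal (fun I l => ~ @perfect_daugavet R X I l) kappa])).
  apply: least_cardinal_exists (unit_sphere_not_perfect_daugavet X0).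
  by move=> I I' A B AB nA /(perfect_daugavet_le AB).
by move=> + _; apply; exact: pfin.
Qed.

(** Every sphere vector is a witness for the empty family, so a failing cardinal is at least 1. *)
Lemma oct_eq1 : (exists x : X, x != 0) -> ~ @octahedral R X _ `I_1 ->
  oct X #= `I_1.
Proof.
move=> X0 noct1.
have nonempty I (A : set I) : ~ @octahedral R X _ A -> A !=set0.
  move=> nA; apply/set0P/eqP => A0; apply: nA => Y e _.
  rewrite A0 => /card_le0P -> _.
  by have [x x1] := unit_sphere_neq0 X0; exists x.
have card_ge1 I (A : set I) : A !=set0 -> `I_1 #<= A.
  move=> [a Aa]; apply: (@card_le_trans _ _ _ [set a]).
    by have := @card_set1 _ a; rewrite card_eq_sym card_eq_le => /andP[].
  by apply: subset_card_le => t ->.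
have card01 : [set 0 : X] #<= `I_1.
  by have := @card_set1 _ (0 : X); rewrite card_eq_le => /andP[].
have [nocto octmin] : least_cardinal (fun I l => ~ @octahedral R X I l) (oct X).
  apply: (xgetPex (set0 : set X)
    (P := [set kappa | least_cardinal (fun I l => ~ @octahedral R X I l) kappa])).
  (* The value of [oct] is a subset of [X], so the cardinal 1 is represented by a singleton
     there. *)
  exists [set 0].
  split=> [oct0|I l /nonempty/card_ge1].
    apply: noct1 => Y e YS Y1; apply: oct0 => //; apply: card_le_trans Y1 _.
    by apply: card_ge1; exists 0.
  exact: card_le_trans.
by rewrite card_eq_le octmin//= card_ge1//; exact: nonempty.
Qed.

End cardinal_invariants.

(** * Norm and evaluation in C(K) *)

Section continuous_functions.
Context {R : realType} {K : topologicalType} {cK : compact [set: K]}.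
Local Notation CK := (contfun R cK).
Implicit Types (f g h : CK) (t : K).

Fact contfun_mul_subproof f g : continuous (fun t => f t * g t : R).
Proof. by move=> t; apply: cvgM; exact: contfun_continuous. Qed.

Definition contfun_cst (a : R) : CK := mkcts (fun t : K => @cst_continuous K R a t).
Definition contfun_mul f g : CK := mkcts (contfun_mul_subproof f g).

Lemma contfun_sumE (L : seq CK) (u : CK -> CK) t :
  (\sum_(g <- L) u g : CK) t = \sum_(g <- L) u g t.
Proof. by elim/big_ind2 : _ => //= _ a _ b <- <-. Qed.

Lemma contfun_norm_leP f (a : R) : 0 <= a ->
  `|f| <= a <-> forall t, `|f t| <= a.
Proof.
move=> a0; split=> [fa t|]; last exact: contfun_norm_le.
exact: le_trans (contfun_norm_ge f t) fa.
Qed.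

(** [f != 0] makes [K] nonempty, as the extreme value theorem requires. *)
Lemma contfun_norm_attained f : f != 0 -> exists t, `|f t| = `|f|.
Proof.
move=> f0.
have K0 : [set: K] !=set0.
  apply: contrapT => K0; move/eqP: f0; apply; apply/contfunP => t.
  by exfalso; apply: K0; exists t.
have cf : {within [set: K], continuous (fun t => `|f t| : R)}.
  apply: continuous_subspaceT => t; apply: cvg_norm.
  exact: contfun_continuous.
have [t _ ft] := compact_EVT_max K0 cK cf.
exists t; apply/eqP; rewrite eq_le contfun_norm_ge.
by apply/contfun_norm_leP => // s; apply: ft; rewrite inE.
Qed.

(** The codomain [R^o] makes evaluation a linear functional, fit for slices and for
    [perturbation]. *)
Definition eval_at t f : R^o := f t.

Fact eval_at_linear t : linear (eval_at t).
Proof. by []. Qed.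

HB.instance Definition _ t :=
  GRing.isLinear.Build R CK R^o _ (eval_at t) (eval_at_linear t).

End continuous_functions.

(** * Bump functions and perturbations *)

Section bump_functions.
Context {R : realType} {K : topologicalType} {cK : compact [set: K]}.
Hypothesis hK : hausdorff_space K.
Local Notation CK := (contfun R cK).
Implicit Types (f g h : CK) (t : K).

(** Urysohn's lemma, compact Hausdorff spaces being normal, for the complement of [U] and the point
    [x]. *)
Lemma bump (U : set K) x : open U -> U x -> exists b : CK,
  [/\ forall t, 0 <= b t <= 1, b x = 1 & forall t, ~ U t -> b t = 0].
Proof.
move=> oU Ux.
have /(normal_separatorP (R := R)) nK := compact_normal hK cK.
have /uniform_separatorP : uniform_separator (~` U) [set x].
  apply: nK; first exact: open_closedC.
    exact/accessible_closed_set1/hausdorff_accessible.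
  by apply/seteqP; split => // t [/= nUt] tx; apply: nUt; rewrite tx.
move=> /(_ R)[b [cb b01 b0 b1]]; exists (mkcts cb); split.
- by move=> t; have /b01 : range b (b t) by []; rewrite /= in_itv.
- by apply: b1; exists x.
- by move=> t Ut; apply: b0; exists t.
Qed.

(** Induction on [N]: a new bump [b] is multiplied by [1 - G], where [G] is the sum of the others,
    and [G + b (1 - G) <= 1]. The others are built to vanish at its peak [p] too, so that it keeps
    the value 1 there. *)
Lemma bumps N (F P : set K) : infinite_set F -> finite_set P ->
  exists L : seq CK, [/\ size L = N,
    forall t, \sum_(g <- L) g t <= 1 &
    forall g, g \in L -> [/\ forall t, 0 <= g t, forall q, P q -> g q = 0 &
      exists2 p, F p & g p = 1]].
Proof.
move=> infF; elim: N P => [|N IH] P finP.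
  by exists [::]; split => // t; rewrite big_nil.
have [p [Fp Pp]] := infinite_setN0 (infinite_setD infF finP).
have [|L [sL L1 Lg]] := IH (p |` P); first by rewrite finite_setU.
have oP : open (~` P).
  apply: closed_openC.
  exact: (accessible_finite_set_closed.1 (hausdorff_accessible hK)).
have [b [b01 bp b0]] := bump _ _ oP Pp.
pose G : CK := \sum_(g <- L) g.
have GE t : G t = \sum_(g <- L) g t by rewrite contfun_sumE.
exists (contfun_mul b (contfun_cst 1 - G) :: L); split => /=.
- by rewrite sL.
- move=> t; rewrite big_cons -GE.
  have /andP[b0t b1t] := b01 t.
  have : G t <= 1 by rewrite GE.
  rewrite [X in X + _](_ : _ = b t * (1 - G t))//.
  by move=> Gt1; nra.
- move=> g; rewrite inE => /predU1P[->|/Lg[g0 gP gF]]; last first.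
    by split => // q Pq; apply: gP; right.
  split.
  + move=> t; rewrite [leRHS](_ : _ = b t * (1 - G t))//.
    by apply: mulr_ge0; [have /andP[] := b01 t|rewrite subr_ge0 GE].
  + move=> q Pq; rewrite [LHS](_ : _ = b q * (1 - G q))//.
    by rewrite b0 ?mul0r// => /(_ Pq).
  + exists p => //; rewrite [LHS](_ : _ = b p * (1 - G p))// bp mul1r GE.
    by rewrite big_seq big1 ?subr0// => k /Lg[_ + _]; apply; left.
Qed.

(* Multiplying [s - f] by [N] bumps of sum at most [1] gives perturbations
   [h_i] of [f] with [sum_i |phi h_i| = phi (sum_i +-h_i) <= 2 M], so that
   [|phi h_i| < d] for some [i] once [N] is large. *)
Lemma perturbation (phi : {linear CK -> R^o}) (M : R) (F P : set K) f (s d : R) :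
  (forall h, `|phi h| <= M * `|h|) -> infinite_set F -> finite_set P ->
  `|f| <= 1 -> `|s| <= 1 -> 0 < d ->
  exists f' p, [/\ `|f'| <= 1, `|phi (f' - f)| < d,
    forall q, P q -> f' q = f q, F p & f' p = s].
Proof.
move=> phiM infF finP f1 s1 d0.
(* The constant 1 has norm at least 1, since [F] supplies a point; the bound on [phi] there gives
   the sign of [M]. *)
have M0 : 0 <= M.
  have := phiM (contfun_cst 1); have : 0 <= `|phi (contfun_cst 1)| by [].
  have [t _] := infinite_setN0 infF.
  have : (1:R) <= `|contfun_cst 1 : CK|.
    by rewrite -[leLHS](@normr1 R); exact: (contfun_norm_ge (contfun_cst 1) t).
  by move=> ? ? ?; nra.
(* This many bumps exceed [2 * M / d], so the values [|phi (h g)|] cannot all reach [d]. *)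
have [L [sL L1 Lg]] := bumps (Num.bound (2 * M / d)) _ _ infF finP.
pose h g : CK := contfun_mul (contfun_cst s - f) g.
have hE g t : h g t = (s - f t) * g t by [].
have {}f1 t : `|f t| <= 1 by move: t; apply/contfun_norm_leP.
have [g gL phig] : exists2 g, g \in L & `|phi (h g)| < d.
  apply: contrapT => nL.
  have phid g : g \in L -> d <= `|phi (h g)|.
    by move=> gL; rewrite leNgt; apply/negP => ?; apply: nL; exists g.
  have : \sum_(g <- L) `|phi (h g)| <= M * 2.
    have -> : \sum_(g <- L) `|phi (h g)| =
        phi (\sum_(g <- L) Num.sg (phi (h g)) *: h g).
      rewrite linear_sum; apply: eq_bigr => g _.
      by rewrite linearZ /= normrEsg.
    apply: le_trans (ler_norm _) _; apply: le_trans (phiM _) _.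
    apply: ler_wpM2l => //; apply/contfun_norm_leP => // t.
    rewrite contfun_sumE; apply: le_trans (ler_norm_sum _ _ _) _.
    apply: (@le_trans _ _ (\sum_(g <- L) 2 * g t)); last first.
      by rewrite -mulr_sumr -[leRHS]mulr1 ler_wpM2l.
    rewrite big_seq [leRHS]big_seq; apply: ler_sum => g /Lg[g0 _ _].
    rewrite [X in `|X|](_ : _ = Num.sg (phi (h g)) * ((s - f t) * g t))//.
    rewrite normrM -[leRHS]mul1r ler_pM// ?normrM ?(ger0_norm (g0 t)).
      by rewrite normr_sg lern1 leq_b1.
    rewrite ler_wpM2r//; apply: le_trans (ler_normB _ _) _.
    by have := f1 t; lra.
  apply/negP; rewrite -ltNge.
  apply: (@lt_le_trans _ _ (\sum_(g <- L) d)); last first.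
    by rewrite big_seq [leRHS]big_seq; exact: ler_sum.
  rewrite big_const_seq count_predT iter_addr_0 sL -[ltRHS]mulr_natl.
  rewrite -ltr_pdivrMr// (mulrC M).
  by apply: archi_boundP; rewrite !mulr_ge0// invr_ge0 ltW.
have [g0 gP [p Fp gp]] := Lg _ gL.
have g1 t : g t <= 1.
  apply: le_trans (L1 t); rewrite (big_rem g)//= lerDl big_seq sumr_ge0// => k.
  by move=> /mem_rem /Lg[].
have fhE t : (f + h g) t = f t + (s - f t) * g t by [].
exists (f + h g), p; split => //.
- apply/contfun_norm_leP => // t; rewrite fhE.
  (* A convex combination of two values of modulus at most 1. *)
  have -> : f t + (s - f t) * g t = (1 - g t) * f t + g t * s by ring.
  apply: le_trans (ler_normD _ _) _; rewrite !normrM.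
  rewrite (ger0_norm (g0 t)) (@ger0_norm _ (1 - g t)) ?subr_ge0//.
  have := f1 t; have := g0 t; have := g1 t; move: s1.
  by move=> ? ? ? ?; nra.
- by rewrite addrC addKr.
- by move=> q Pq; rewrite fhE gP// mulr0 addr0.
- by rewrite fhE gp; ring.
Qed.

End bump_functions.

(** * Isolated points and G_delta points *)

Section isolated_and_Gdelta_points.
Context {R : realType} {K : topologicalType} {cK : compact [set: K]}.
Hypothesis hK : hausdorff_space K.
Local Notation CK := (contfun R cK).

Lemma open_setD_finite (U F : set K) : open U -> finite_set F -> open (U `\` F).
Proof.
move=> oU finF; rewrite setDE; apply: openI => //; apply: closed_openC.
exact: (accessible_finite_set_closed.1 (hausdorff_accessible hK)).
Qed.

(** Removing from a finite open set all points but one leaves an open singleton. *)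
Lemma open_infinite (U : set K) : (~ exists x : K, isolated [set: K] x) ->
  open U -> U !=set0 -> infinite_set U.
Proof.
move=> nI oU [x Ux] finU; apply: nI; exists x; split; first by rewrite inE.
exists [set x]; last by rewrite setIT.
have -> : [set x] = U `\` (U `\ x).
  apply/seteqP; split => t /=; first by move=> ->; split => // -[_]; apply.
  by move=> [Ut nUt]; apply: contrapT => tx; apply: nUt.
apply: open_nbhs_nbhs; split; last by split => // -[_]; apply.
by apply: open_setD_finite => //; exact: finite_setD.
Qed.

(** If the level set were finite, the open sets [|f - s| < 1 / (n + 1)], with its points other than
    [x] removed, would intersect in [x] alone. *)
Lemma level_set_infinite (f : CK) (s : R) : (~ exists x : K, Gdelta [set x]) ->
  (exists x, f x = s) -> infinite_set [set t | f t = s].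
Proof.
move=> nG [x fx] finF; apply: nG; exists x.
pose F := [set t | f t = s] `\ x.
have finF' : finite_set F by exact: finite_setD.
exists (fun n => [set t | `|f t - s| < n.+1%:R^-1] `\` F) => [n|].
  apply: open_setD_finite => //.
  rewrite (_ : mkset _ = (fun t => `|f t - s| : R) @^-1` [set r | r < n.+1%:R^-1]).
    apply: open_comp; last exact: open_lt.
    move=> t _; apply: cvg_norm; apply: cvgB; last exact: cvg_cst.
    exact: contfun_continuous.
  by [].
apply/seteqP; split => [t -> n _ /=|t tF].
  by split; [rewrite fx subrr normr0 invr_gt0|case=> _; apply].
have [] := tF 0%N I => _ /= nFt; apply: contrapT => tx; apply: nFt; split => //.
apply/eqP; rewrite -subr_eq0 -normr_le0; apply/ler_addgt0Pr => e e0.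
rewrite add0r; have [n ne] := ltr_add_invr e0.
rewrite add0r in ne; apply: ltW; apply: lt_trans ne.
by have [] := tF n I.
Qed.

(* The witness is [1 - sup_n (1 - b_n) / (n + 1)], where [b_n] is a bump at [x]
   supported in the [n]-th open set. *)
Lemma Gdelta_peak (x : K) : Gdelta [set x] -> exists f : CK,
  [/\ forall t, 0 <= f t <= 1, f x = 1 & forall t, f t = 1 -> t = x].
Proof.
move=> [U oU xU].
have Ux n : U n x by have : [set x] x by []; rewrite xU; apply.
have /choice[b bP] : forall n, exists b : CK,
    [/\ forall t, 0 <= b t <= 1, b x = 1 & forall t, ~ U n t -> b t = 0].
  by move=> n; exact: bump.
pose c n t : R := (1 - b n t) / n.+1%:R.
have c0 n t : 0 <= c n t.
  have [b01 _ _] := bP n; have /andP[_ bt1] := b01 t.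
  by rewrite mulr_ge0 ?invr_ge0 ?subr_ge0.
have cn n t : c n t <= n.+1%:R^-1.
  have [b01 _ _] := bP n; have /andP[bt0 _] := b01 t.
  by rewrite ler_piMl ?invr_ge0// gerBl.
have cc n : continuous (c n).
  move=> t; apply: cvgM; last exact: cvg_cst.
  by apply: cvgB; [exact: cvg_cst|exact: contfun_continuous].
have ub t : has_ubound (range (c ^~ t)).
  exists 1 => _ [n _ <-]; apply: le_trans (cn n t) _.
  by rewrite invf_le1// ler1n.
pose w t : R := sup (range (c ^~ t)).
have cw n t : c n t <= w t by apply: sup_ubound => //; exists n.
have wle t a : (forall n, c n t <= a) -> w t <= a.
  by move=> ca; apply: ge_sup; [exists (c 0%N t), 0%N|move=> _ [n _ <-]].
have w0 t : 0 <= w t by exact: le_trans (c0 0%N t) (cw 0%N t).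
have w1 t : w t <= 1.
  apply: wle => n; apply: le_trans (cn n t) _.
  by rewrite invf_le1// ler1n.
(* For [n >= N] the values of [c n] all lie in [[0, e]], so only the finitely many [c n] with
   [n < N] constrain the neighbourhood of [t]. *)
have ctsw : continuous w.
  move=> t; apply/cvgrPdist_le => e e0.
  have [N Ne] := ltr_add_invr e0; rewrite add0r in Ne.
  have near_c : \forall s \near t, forall n, (n < N)%N -> `|c n t - c n s| <= e.
    elim: N {Ne} => [|N IH]; first by near=> s.
    have /cvgrPdist_le /(_ _ e0) cNt := cc N t.
    near=> s => n; rewrite ltnS leq_eqVlt => /predU1P[->|].
      by near: s; exact: cNt.
    by move: n; near: s.
  near=> s.
  have cst n : `|c n t - c n s| <= e.
    have [nN|Nn] := ltnP n N; first by move: n nN; near: s.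
    have nNe : n.+1%:R^-1 <= e.
      apply/ltW/le_lt_trans/Ne.
      by rewrite lef_pV2 ?posrE// ler_nat.
    have := le_trans (cn n t) nNe; have := le_trans (cn n s) nNe.
    by have := c0 n t; have := c0 n s => ? ? ? ?; rewrite ler_norml; apply/andP; split; lra.
  rewrite ler_norml; apply/andP; split.
    suff : w s <= w t + e by lra.
    apply: wle => n; have := cst n; have := cw n t.
    by rewrite ler_norml => ? /andP[]; lra.
  suff : w t <= w s + e by lra.
  apply: wle => n; have := cst n; have := cw n s.
  by rewrite ler_norml => ? /andP[]; lra.
have ctsf : continuous (fun t => 1 - w t : R).
  by move=> t; apply: cvgB; [exact: cvg_cst|exact: ctsw].
exists (mkcts ctsf); split.
- by move=> t /=; rewrite subr_ge0 w1 gerBl w0.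
- suff wx : w x = 0 by rewrite [LHS](_ : _ = 1 - w x)// wx subr0.
  apply/eqP; rewrite eq_le w0 andbT; apply: wle => n.
  by have [_ bx _] := bP n; rewrite /c bx subrr mul0r.
- move=> t ft; have wt : w t = 0.
    by have : 1 - w t = 1 := ft; lra.
  suff : [set x] t by [].
  rewrite xU => n _; apply: contrapT => nUt.
  (* Outside [U n] the bump vanishes, so [c n t = 1 / (n + 1)] would exceed [w t = 0]. *)
  have [_ _ /(_ t nUt) bt0] := bP n.
  have := cw n t; rewrite wt /c bt0 subr0 mul1r.
  by apply/negP; rewrite -ltNge invr_gt0.
Unshelve. all: by end_near.
Qed.

End isolated_and_Gdelta_points.

(** * Daugavet property and octahedrality of C(K) *)

Section daugavet_properties.
Context {R : realType} {K : topologicalType} {cK : compact [set: K]}.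
Hypothesis hK : hausdorff_space K.
Local Notation CK := (contfun R cK).
Implicit Types (f g : CK) (t : K).

(** Isolation makes the singleton a neighbourhood of [x]; a bump supported in its interior vanishes
    off [x]. *)
Lemma isolated_indicator (x : K) : isolated [set: K] x -> exists b : CK,
  [/\ b x = 1, forall t, t <> x -> b t = 0 & `|b| = 1].
Proof.
move=> [_ [V nV]]; rewrite setIT => Vx; rewrite Vx in nV.
have [b [b01 bx b0]] := bump (R := R) (cK := cK) hK _ _ (@open_interior _ [set x]) nV.
exists b; split=> // [t tx|]; first by apply: b0 => /interior_subset.
apply/eqP; rewrite eq_le; apply/andP; split.
  by apply/contfun_norm_leP => // t; have /andP[b0t] := b01 t; rewrite ger0_norm.
by have := contfun_norm_ge b x; rewrite bx normr1.
Qed.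

(** For [|y| = 1], both [b + y] and [b - y] have modulus at most 1 off [x], and at [x] the sign of
    [y x] puts one of [1 + y x], [1 - y x] in [[0, 1]]. *)
Lemma not_octahedral_isolated (x : K) : isolated [set: K] x ->
  ~ @octahedral R CK _ `I_1.
Proof.
move=> /isolated_indicator[b [bx b0 b1]] oct1.
have [|||y /= y1 /(_ b erefl)[]] := oct1 [set b] 2^-1.
- by move=> _ ->.
- by have := @card_set1 _ b; rewrite card_eq_le => /andP[].
- by rewrite invr_gt0.
have {}y1 t : `|y t| <= 1 by move: t; apply/contfun_norm_leP => //; rewrite y1.
rewrite !ltNge; have [yx0|yx0] := leP (y x) 0 => byp bym.
  move/negP: byp; apply; apply/contfun_norm_leP => [|t]; first by lra.
  rewrite [X in `|X|](_ : _ = b t + y t)//.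
  have := y1 t; rewrite !ler_norml => /andP[? ?]; apply/andP.
  by have [tx|/b0 ->] := pselect (t = x); [subst t; rewrite bx|]; split; lra.
move/negP: bym; apply; apply/contfun_norm_leP => [|t]; first by lra.
rewrite [X in `|X|](_ : _ = b t - y t)//.
have := y1 t; rewrite !ler_norml => /andP[? ?]; apply/andP.
by have [tx|/b0 ->] := pselect (t = x); [subst t; rewrite bx|]; split; lra.
Qed.

(** [f + T f] vanishes at [x] and equals [f] elsewhere, so its norm is at most [|f|], whereas
    [T b = - b] gives [T] norm at least 1. *)
Lemma not_daugavet_isolated (x : K) : isolated [set: K] x -> ~ daugavet CK.
Proof.
move=> /isolated_indicator[b [bx b0 b1]].
pose T f : CK := f x *: - b.
have TE f t : T f t = f x * - b t by [].
have Tlin : linear T.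
  move=> a f g; apply/contfunP => t; rewrite TE.
  rewrite [LHS](_ : _ = (a * f x + g x) * - b t)//.
  by rewrite [RHS](_ : _ = a * (f x * - b t) + g x * - b t)//; ring.
pose Tlin' := GRing.isLinear.Build R CK CK _ T Tlin.
pose T' : {linear CK -> CK} := HB.pack T Tlin'.
have Tnorm f : `|T f| = `|f x| by rewrite normrZ normrN b1 mulr1.
move=> /(_ T') DT.
have {}DT : opnorm (fun f => f + T' f) = 1 + opnorm T'.
  apply: DT => [r|].
    by exists r => f fr; rewrite Tnorm; apply: le_trans fr; exact: contfun_norm_ge.
  exists (- b); first by rewrite oppr_eq0 -normr_eq0 b1 oner_eq0.
  apply/seteqP; split => [_ [f _ <-]|_ [a _ <-]]; first by exists (f x).
  by exists (contfun_cst a).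
have opT : 1 <= opnorm T'.
  apply: sup_ubound.
    exists 1 => _ [f f1 <-]; rewrite Tnorm.
    by apply: le_trans f1; exact: contfun_norm_ge.
  by exists b; rewrite /= ?b1// Tnorm bx normr1.
suff : opnorm (fun f => f + T' f) <= 1 by rewrite DT; lra.
apply: ge_sup; first by exists `|0 + T' 0|, 0 => //=; rewrite normr0.
move=> _ [f f1 <-]; apply/contfun_norm_leP => // t.
rewrite [X in `|X|](_ : _ = f t + f x * - b t)//.
have [->|/b0 ->] := pselect (t = x).
  by rewrite bx mulrN1 subrr normr0.
by rewrite oppr0 mulr0 addr0; apply: le_trans f1; exact: contfun_norm_ge.
Qed.

(* As [T] has rank one, [`|T f|] is [`|T f z|] for one point [z] independent of
   [f]; moving an almost maximal [f] to the value [1] at some point where [T f]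
   is almost maximal hardly changes [f] under the functional [T _ z]. *)
Lemma daugavet_no_isolated : (~ exists x : K, isolated [set: K] x) ->
  daugavet CK.
Proof.
move=> nI T Tbnd [e e0 rT].
have [z ez] := contfun_norm_attained e e0.
have Tz f : `|T f| = `|T f z|.
  have [a _ <-] : [set a *: e | a in [set: R]] (T f) by rewrite -rT; exists f.
  by rewrite normrZ -ez -normrM.
have [M TM] : exists M, forall f, `|T f| <= M * `|f|.
  have /linear_boundedP[M [_ MP]] := (bounded_funP T).1 Tbnd.
  by exists (M + 1) => f; apply: (MP (M + 1)); rewrite ltrDl.
have imT0 : [set `|T f| | f in unit_ball CK] !=set0.
  by exists `|T 0|, 0 => //=; rewrite normr0.
have M0 : 0 <= M.
  by have := TM e; have := normr_ge0 (T e); have : 0 < `|e|; [rewrite normr_gt0|nra].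
have Tub : has_ubound [set `|T f| | f in unit_ball CK].
  by exists M => _ [f /= f1 <-]; have := TM f; nra.
have addTle f : `|f| <= 1 -> `|f + T f| <= 1 + opnorm T.
  move=> f1; apply: le_trans (ler_normD _ _) _; apply: lerD => //.
  by apply: sup_ubound => //; exists f.
have addTub : has_ubound [set `|f + T f| | f in unit_ball CK].
  by exists (1 + opnorm T) => _ [f f1 <-]; exact: addTle.
apply/eqP; rewrite eq_le; apply/andP; split.
  apply: ge_sup; first by exists `|0 + T 0|, 0 => //=; rewrite normr0.
  by move=> _ [f f1 <-]; exact: addTle.
apply/ler_addgt0Pr => d d0.
have d20 : 0 < d / 2 by rewrite divr_gt0.
have [f f1 Tfz] : exists2 f, `|f| <= 1 & opnorm T - d / 2 < T f z.
  have [_ [f /= f1 <-]] := sup_adherent d20 (conj imT0 Tub).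
  (* Passing to [- f] if necessary turns a large modulus at [z] into a large value. *)
  rewrite Tz => Tf; have [Tfz|Tfz] := leP 0 (T f z).
    by exists f => //; move: Tf; rewrite ger0_norm.
  exists (- f); first by rewrite normrN.
  by rewrite linearN [ltRHS](_ : _ = - T f z)//; move: Tf; rewrite ltr0_norm.
have infU : infinite_set [set t | opnorm T - d / 2 < T f t].
  apply: open_infinite => //; last by exists z.
  rewrite (_ : mkset _ = T f @^-1` [set r | opnorm T - d / 2 < r])//.
  by apply: open_comp; [move=> t _; exact: contfun_continuous|exact: open_gt].
have TzM h : `|(eval_at z \o T) h| <= M * `|h|.
  by apply: le_trans (TM h); exact: contfun_norm_ge.
have norm1 : `|1 : R| <= 1 by rewrite normr1.
have [f' [p [f'1 Tf'f _ /= Tfp f'p]]] := perturbation hK _ _ _ _ _ 1 _ TzM infU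
  (@finite_set0 K) f1 norm1 d20.
(* The norm of [T (f' - f)] is its modulus at [z], so smallness there carries over to [p]. *)
have Tf'p : opnorm T - d < T f' p.
  have : `|T (f' - f)| < d / 2 by rewrite Tz.
  move=> /(le_lt_trans (contfun_norm_ge _ p)).
  by rewrite linearB [X in `|X|](_ : _ = T f' p - T f p)// ltr_norml => /andP[]; lra.
have := contfun_norm_ge (f' + T f') p.
rewrite [X in `|X|](_ : _ = f' p + T f' p)// f'p => fTp.
have : `|f' + T f'| <= opnorm (fun f => f + T f).
  by apply: sup_ubound => //; exists f'.
have := le_trans (ler_norm _) fTp.
by rewrite [contfun_norm _](_ : _ = `|f' + T f'|)//; lra.
Qed.

End daugavet_properties.

(** * The perfect Daugavet property of C(K) *)

Section perfect_daugavet_property.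
Context {R : realType} {K : topologicalType} {cK : compact [set: K]}.
Hypothesis hK : hausdorff_space K.
Local Notation CK := (contfun R cK).
Implicit Types (f g : CK) (t : K).

(** If [|f - y| = 2] is attained at [t], then [0 <= y <= 1] and [|f| <= 1] force [y t = 1] and
    [f t = -1], hence [t = x], against [f x > 0]. *)
Lemma not_perfect_daugavet_Gdelta (x : K) : Gdelta [set x] ->
  ~ @perfect_daugavet R CK _ `I_1.
Proof.
move=> /(Gdelta_peak (R := R) (cK := cK) hK)[y [y01 yx ypeak]] pD.
have y1 : `|- y| = 1.
  rewrite normrN; apply/eqP; rewrite eq_le; apply/andP; split.
    by apply/contfun_norm_leP => // t; have /andP[yt0] := y01 t; rewrite ger0_norm.
  by have := contfun_norm_ge y x; rewrite yx normr1.
pose S := [set f : CK | `|f| <= 1 /\ 0 < f x].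
have sliceS : slice S.
  exists (eval_at x : {linear CK -> R^o}), 1; split => //.
    apply/linear_bounded_continuous/bounded_funP => r; exists r => f fr.
    by apply: le_trans fr; exact: contfun_norm_ge.
  (* Evaluation at [x] has supremum 1 on the ball, attained at [y], so [a = 1] puts the threshold at
     0. *)
  rewrite (_ : sup _ = 1) ?subrr//; apply/eqP; rewrite eq_le; apply/andP; split.
    apply: ge_sup; first by exists (eval_at x (0 : CK)), 0 => //=; rewrite normr0.
    move=> _ [f /= f1 <-]; apply: le_trans f1; apply: le_trans (ler_norm _) _.
    exact: contfun_norm_ge.
  apply: sup_ubound; last by exists y => //=; rewrite -normrN y1.
  exists 1 => _ [f /= f1 <-]; apply: le_trans f1; apply: le_trans (ler_norm _) _.
  exact: contfun_norm_ge.
have [|//|f [f1 fx] /(_ _ erefl) yf] := pD [set - y] S _ _ sliceS.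
- by move=> _ ->.
- by have := @card_set1 _ (- y); rewrite card_eq_le => /andP[].
have yf0 : - y + f != 0 by rewrite -normr_eq0 yf pnatr_eq0.
have [t] := contfun_norm_attained _ yf0; rewrite yf.
rewrite [X in `|X|](_ : _ = - y t + f t)// => yft.
have := contfun_norm_ge f t => /le_trans/(_ f1); rewrite ler_norml => /andP[ft1 ft2].
have /andP[yt0 yt1] := y01 t.
have [] : y t = 1 /\ f t = -1.
  move: yft; have [_|_] := ger0P (- y t + f t); lra.
by move=> /ypeak tx; move: fx; rewrite -tx => + ft; rewrite ft oppr_gt0 ltr10.
Qed.

Lemma perfect_daugavet_finite I (A : set I) :
  (~ exists x : K, Gdelta [set x]) -> finite_set A -> @perfect_daugavet R CK _ A.
Proof.
move=> nG finA Y S Y1 /card_le_finite/(_ finA) finY [phi [a [cphi a0 ->]]].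
set c := sup _ - a.
have /linear_boundedP[m [_ mP]] := continuous_linear_bounded 0 (cphi 0).
have phiM f : `|phi f| <= (m + 1) * `|f| by apply: (mP (m + 1)); rewrite ltrDl.
have [f0 f01 cf0] : exists2 f : CK, `|f| <= 1 & c < phi f.
  have [||_ [f f1 <-] cf] := @sup_adherent R [set phi z | z in unit_ball CK] a.
  - exact: a0.
  - split; first by exists (phi 0), 0 => //=; rewrite normr0.
    exists (`|m + 1|) => _ [f /= f1 <-].
    apply: le_trans (ler_norm _) _; apply: le_trans (phiM f) _.
    by apply: le_trans (ler_norm _) _; rewrite normrM normr_id ler_piMr.
  - by exists f.
have /finite_seqP[s Ys] := finY.
(* For the induction on [s], [P] records the points where the sums reach 2; later perturbations keep
   [f] unchanged on [P]. *)
suff [f [P [finP f1 cf fP]]] : exists f (P : set K), [/\ finite_set P, `|f| <= 1,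
    c < phi f & forall y, y \in s -> exists2 p, P p & `|y p + f p| = 2].
  exists f => // y Yy; have y1 := Y1 _ Yy.
  apply/eqP; rewrite eq_le; apply/andP; split.
    by apply: le_trans (ler_normD _ _) _; rewrite y1; lra.
  have [|p _ <-] := fP y; first by move: Yy; rewrite Ys.
  exact: (contfun_norm_ge (y + f) p).
have {Ys finY} : forall y, y \in s -> `|y| = 1.
  by move=> y ys; apply: Y1; rewrite Ys.
elim: s => [_|y s IH ys1]; first by exists f0, set0; split.
have [|f [P [finP f1 cf fP]]] := IH.
  by move=> z zs; apply: ys1; rewrite inE zs orbT.
have y1 : `|y| = 1 by apply: ys1; rewrite mem_head.
have y0 : y != 0 by rewrite -normr_eq0 y1 oner_eq0.
have [q yq] := contfun_norm_attained _ y0; rewrite y1 in yq.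
have infF := level_set_infinite hK y (y q) nG (ex_intro _ q erefl).
have yq1 : `|y q| <= 1 by rewrite yq.
(* The slack in the strict slice inequality is the change of [phi] that the next perturbation may
   make. *)
have cf0' : 0 < phi f - c by rewrite subr_gt0.
have [f' [p [f'1 phif' f'P /= yp f'p]]] :=
  perturbation hK _ _ _ _ _ _ _ phiM infF finP f1 yq1 cf0'.
exists f', (p |` P); split => //.
- by rewrite finite_setU.
- by move: phif'; rewrite linearB ltr_norml => /andP[]; lra.
- move=> z; rewrite inE => /predU1P[->|/fP[r Pr zr]].
    by exists p; [left|rewrite yp f'p -mulr2n normrMn yq].
  by exists r; [right|rewrite f'P].
Qed.

End perfect_daugavet_property.

Theorem theorem4p1 (R : realType) (K : topologicalType)
    (hK : hausdorff_space K) (cK : compact [set: K]) :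
  ((daugavet (contfun R cK) <-> ~ exists x : K, isolated [set: K] x) /\
   ((exists x : K, isolated [set: K] x) -> oct (contfun R cK) #= `I_1)) /\
  ((perfect_daugavet (contfun R cK) `I_1 <->
      ~ exists x : K, Gdelta [set x]) /\
   ((~ exists x : K, Gdelta [set x]) ->
      (exists f : contfun R cK, f != 0) ->
      [set: nat] #<= pDau (contfun R cK))).
Proof.
split; split.
- split; last exact: daugavet_no_isolated.
  by move=> D [x ix]; exact: (not_daugavet_isolated hK x ix D).
- move=> [x ix]; apply: oct_eq1; last exact: (not_octahedral_isolated hK x ix).
  have [b [_ _ b1]] := isolated_indicator (R := R) (cK := cK) hK x ix.
  by exists b; rewrite -normr_eq0 b1 oner_eq0.
- split; first by move=> pD [x Gx]; exact: (not_perfect_daugavet_Gdelta hK x Gx pD).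
  by move=> nG; apply: perfect_daugavet_finite => //; exact: finite_II.
- move=> nG K0; apply: infinite_pDau => // I A.
  exact: perfect_daugavet_finite.
Qed.
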